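(* Let $F:\mathbb{R}^n\to\mathbb{R}^m$ be smooth, let $D\subset\mathbb{R}^m$ be a closed set that is Clarke regular at every one of its points, and let $S:\mathbb{R}^n\rightrightarrows\mathbb{R}^m$ be given by $S(x)=F(x)-D=\{F(x)-d\mid d\in D\}$. Suppose $(\bar x,\bar u)\in\mathrm{gph}(S)$. (Then $S^{-1}(u)$ consists of all $x$ satisfying the constraint system $F(x)-u\in D$, with $u$ as a parameter.) Suppose $H:\mathbb{R}^m\rightrightarrows\mathbb{R}^n$ is a prefan such that for all $p\in\mathbb{R}^m\setminus\{0\}$ there exists $q\in-H(-p)$ such that $\nabla F(\bar x)q-p\in T_D(F(\bar x)-\bar u)$. Then $S^{-1}:\mathbb{R}^m\rightrightarrows\mathbb{R}^n$ is pseudo strictly $H$-differentiable at $(\bar u,\bar x)$.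
   Context: ''Smooth'' means continuously differentiable; $\nabla F(\bar x)$ is the $m\times n$ Jacobian matrix. A set-valued map $S:\mathbb{R}^n\rightrightarrows\mathbb{R}^m$ assigns to each $x$ a subset $S(x)\subset\mathbb{R}^m$; its graph is $\mathrm{gph}(S)=\{(x,y)\mid y\in S(x)\}$ and its inverse is $S^{-1}(y)=\{x\mid y\in S(x)\}$. $\mathbb{B}$ is the closed unit ball. $H:\mathbb{R}^m\rightrightarrows\mathbb{R}^n$ is positively homogeneous if $0\in H(0)$ and $H(kw)=kH(w)$ for all $k>0$ and all $w$. For a real $\delta>0$, $(H+\delta)(w):=H(w)+\delta\|w\|\mathbb{B}$. $H$ is a prefan if it is positively homogeneous, $H(p)$ is nonempty, convex and compact for all $p$, and $\sup_{\|w\|\le1}\sup_{z\in H(w)}\|z\|$ is finite. A map $R:\mathbb{R}^m\rightrightarrows\mathbb{R}^n$ is pseudo strictly $H$-differentiable at $(\bar u,\bar x)\in\mathrm{gph}(R)$ if for any $\delta>0$ there are neighborhoods $U_\delta$ of $\bar u$ and $V_\delta$ of $\bar x$ such that $R(u)\cap V_\delta\subset R(u')+(H+\delta)(u-u')$ for all $u,u'\in U_\delta$. For a set $C$ and $\bar z\in C$, the tangent (contingent) cone $T_C(\bar z)$ is the set of $w$ such that $(z_i-\bar z)/\tau_i\to w$ for some $z_i\to\bar z$, $z_i\in C$, $\tau_i\searrow0$. A closed set $C\subset\mathbb{R}^N$ is Clarke regular at $\bar z\in C$ if $T_C:C\rightrightarrows\mathbb{R}^N$ is inner semicontinuous at $\bar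 z$: for every $\rho>0$ and $\epsilon>0$ there is a neighborhood $V$ of $\bar z$ such that $T_C(\bar z)\cap\rho\mathbb{B}\subset T_C(z)+\epsilon\mathbb{B}$ for all $z\in C\cap V$. *)

(* Defs.v *)
From HB Require Import structures.
From mathcomp Require Import all_boot all_order all_algebra.
From mathcomp Require Import all_classical all_reals all_analysis.

Set Implicit Arguments.
Unset Strict Implicit.
Unset Printing Implicit Defensive.

Import Order.TTheory GRing.Theory Num.Theory.
Import numFieldNormedType.Exports.

Local Open Scope classical_set_scope.
Local Open Scope ring_scope.

(* R^n is 'rV[R]_n. The library norm `|x| on 'rV[R]_n is the maximum norm, so
   the Euclidean norm is introduced here; both induce the same topology, and
   nbhs, closed, compact, convergence and differentiability below are the
   library's. *)
Definition enorm (R : realType) (n : nat) (x : 'rV[R]_n) : R :=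
  Num.sqrt (\sum_(i < n) x ord0 i ^+ 2).

Definition unit_ball (R : realType) (n : nat) : set 'rV[R]_n :=
  [set x | enorm x <= 1].
Arguments unit_ball {R n}.

Definition set_add (V : zmodType) (A B : set V) : set V :=
  [set z | exists x y, [/\ A x, B y & z = x + y]].

Definition set_scale (R : realType) (V : lmodType R) (k : R) (A : set V) :
  set V := [set k *: x | x in A].

(* A set-valued map from X to Y is a function X -> set Y. *)
Definition gph (X Y : Type) (S : X -> set Y) : set (X * Y) :=
  [set xy | S xy.1 xy.2].

Definition set_inv (X Y : Type) (S : X -> set Y) : Y -> set X :=
  fun y => [set x | S x y].

(* In the library's row-vector convention 'J F x is the n x m transpose of the
   usual Jacobian matrix, and it acts on vectors by q |-> q *m 'J F x. *)
Definition smooth (R : realType) (n m : nat) (F : 'rV[R]_n -> 'rV[R]_m) :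
  Prop :=
  (forall x, differentiable F x) /\ continuous (fun x => 'J F x).

Definition pos_homogeneous (R : realType) (m n : nat)
    (H : 'rV[R]_m -> set 'rV[R]_n) : Prop :=
  H 0 0 /\ forall (k : R) (w : 'rV[R]_m), 0 < k -> H (k *: w) = set_scale k (H w).

Definition enlarge (R : realType) (m n : nat) (H : 'rV[R]_m -> set 'rV[R]_n)
    (delta : R) : 'rV[R]_m -> set 'rV[R]_n :=
  fun w => set_add (H w) (set_scale (delta * enorm w) unit_ball).

(* the extended real sup_{|w| <= 1} sup_{z in H(w)} |z| *)
Definition outer_norm (R : realType) (m n : nat)
    (H : 'rV[R]_m -> set 'rV[R]_n) : \bar R :=
  ereal_sup [set ereal_sup [set (enorm z)%:E | z in H w] | w in unit_ball].

Definition prefan (R : realType) (m n : nat) (H : 'rV[R]_m -> set 'rV[R]_n) :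
  Prop :=
  [/\ pos_homogeneous H,
      forall p, [/\ H p !=set0, convex_set (H p) & compact (H p)]
    & (outer_norm H < +oo)%E].

Definition pseudo_strictly_differentiable (R : realType) (m n : nat)
    (H Q : 'rV[R]_m -> set 'rV[R]_n) (ubar : 'rV[R]_m) (xbar : 'rV[R]_n) :
  Prop :=
  gph Q (ubar, xbar) /\
  forall delta : R, 0 < delta ->
    exists (U : set 'rV[R]_m) (V : set 'rV[R]_n),
      [/\ nbhs ubar U, nbhs xbar V
        & forall u u', U u -> U u' ->
            Q u `&` V `<=` set_add (Q u') (enlarge H delta (u - u'))].

Definition tangent_cone (R : realType) (N : nat) (C : set 'rV[R]_N)
    (zbar : 'rV[R]_N) : set 'rV[R]_N :=
  [set w | exists (z : nat -> 'rV[R]_N) (tau : nat -> R),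
     [/\ forall i, C (z i), z @ \oo --> zbar,
         forall i, 0 < tau i, tau @ \oo --> (0 : R)
       & (fun i => (tau i)^-1 *: (z i - zbar)) @ \oo --> w]].

Definition clarke_regular (R : realType) (N : nat) (C : set 'rV[R]_N)
    (zbar : 'rV[R]_N) : Prop :=
  forall rho eps : R, 0 < rho -> 0 < eps ->
    exists2 V : set 'rV[R]_N, nbhs zbar V &
      forall z, (C `&` V) z ->
        tangent_cone C zbar `&` set_scale rho unit_ball
          `<=` set_add (tangent_cone C z) (set_scale eps unit_ball).

(* Main.v *)
(* The constraint map S x = F x - D is treated as an arbitrary set-valued map
   with closed graph. Suppose that the direction (q, p) is, up to a small error,
   tangent to the graph of S at all nearby points. Then minimizing
   |y - u - t p| - d t over t in [0, 1] and y in S(x + t q) cannot stop before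
   t = 1, so S(x + q) meets the ball of radius d around u + p. Directions with
   |q| <= k |p| for every p also allow any residual y - v to be decreased at the
   cost of a proportional displacement of x; minimizing
   kappa |y' - v| + |x' - x| then yields x' with v in S(x') and
   |x' - x| <= kappa |y - v|. Combining the two, S^-1(u + p) has a point close
   to x + q. Clarke regularity of D and continuity of the Jacobian spread the
   tangency assumed at the reference point to its neighborhood, with the same
   q. *)

Require Import Defs.
From HB Require Import structures.
From mathcomp Require Import all_boot all_order all_algebra.
From mathcomp Require Import all_classical all_reals all_analysis.
From mathcomp Require Import lra.

Set Implicit Arguments.
Unset Strict Implicit.
Unset Printing Implicit Defensive.

Import Order.TTheory GRing.Theory Num.Theory.
Import numFieldNormedType.Exports.

Local Open Scope classical_set_scope.
Local Open Scope ring_scope.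

Section matrix_norm.
Variable R : realType.

Lemma ler_sum_ord n (f : 'I_n -> R) (c : R) :
  (forall i, f i <= c) -> \sum_(i < n) f i <= n%:R * c.
Proof.
move=> fc; rewrite mulr_natl -[X in _ *+ X]card_ord -sumr_const.
exact: ler_sum.
Qed.

Lemma normr_coord_le m n (A : 'M[R]_(m, n)) i j : `|A i j| <= `|A|.
Proof.
rewrite [leRHS]/Num.norm /= mx_normrE.
exact: (le_bigmax 0 (fun ij : 'I_m * 'I_n => `|A ij.1 ij.2|) (i, j)).
Qed.

Lemma normr_mx_le m n (A : 'M[R]_(m, n)) (c : R) :
  0 <= c -> (forall i j, `|A i j| <= c) -> `|A| <= c.
Proof.
move=> c0 Ac; rewrite [leLHS]/Num.norm /= mx_normrE.
by apply: bigmax_le => // -[i j] _; exact: Ac.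
Qed.

Lemma normr_mulmx_le m n p (A : 'M[R]_(m, n)) (B : 'M[R]_(n, p)) :
  `|A *m B| <= n%:R * `|A| * `|B|.
Proof.
apply: normr_mx_le => [|i j]; first by rewrite !mulr_ge0.
rewrite mxE (le_trans (ler_norm_sum _ _ _))// -mulrA.
apply: ler_sum_ord => k; rewrite normrM.
by apply: ler_pM; rewrite ?normr_coord_le.
Qed.

Lemma compact_closed_ball_rV n (x : 'rV[R]_n) (r : R) :
  compact (closed_ball_ Num.norm x r).
Proof.
apply: bounded_closed_compact; last exact: closed_closed_ball_.
exists (`|x| + r); split=> [|M /ltW rM y /= xy]; first exact: num_real.
apply: le_trans rM; rewrite -[y](subKr x).
by rewrite (le_trans (ler_normB _ _))// lerD2l.
Qed.

End matrix_norm.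

Section euclidean_norm.
Variables (R : realType) (n : nat).
Implicit Types (x : 'rV[R]_n) (k : R).

Lemma enorm_ge0 x : 0 <= enorm x.
Proof. exact: sqrtr_ge0. Qed.

Lemma sqr_enorm x : enorm x ^+ 2 = \sum_(i < n) x ord0 i ^+ 2.
Proof. by rewrite sqr_sqrtr// sumr_ge0// => i _; exact: sqr_ge0. Qed.

Lemma normr_le_enorm x : `|x| <= enorm x.
Proof.
apply: normr_mx_le => [|i j]; first exact: enorm_ge0.
rewrite (ord1 i) -(ler_pXn2r (n := 2)) ?nnegrE ?enorm_ge0//.
rewrite sqr_enorm real_normK ?num_real// (bigD1 j)//= lerDl.
by rewrite sumr_ge0// => k _; exact: sqr_ge0.
Qed.

Lemma enorm_le_normr x : enorm x <= n%:R * `|x|.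
Proof.
rewrite -(ler_pXn2r (n := 2)) ?nnegrE ?enorm_ge0 ?mulr_ge0// sqr_enorm.
apply: (@le_trans _ _ (n%:R * `|x| ^+ 2)).
  apply: ler_sum_ord => i; rewrite -real_normK ?num_real//.
  by rewrite ler_pXn2r ?nnegrE// normr_coord_le.
rewrite exprMn ler_wpM2r ?sqr_ge0// -natrX ler_nat.
by case: n {x} => // n'; rewrite leq_pmulr.
Qed.

Lemma enormZ k x : enorm (k *: x) = `|k| * enorm x.
Proof.
rewrite /enorm -sqrtr_sqr -sqrtrM ?sqr_ge0// mulr_sumr.
by congr Num.sqrt; apply: eq_bigr => i _; rewrite mxE exprMn.
Qed.

Lemma enorm0 : enorm (0 : 'rV[R]_n) = 0.
Proof. by rewrite -(scale0r 0) enormZ normr0 mul0r. Qed.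

Lemma unit_ballZV k x : 0 < k -> enorm x <= k -> unit_ball (k^-1 *: x).
Proof.
move=> k0 xk; rewrite /unit_ball /= enormZ gtr0_norm ?invr_gt0//.
by rewrite mulrC ler_pdivrMr// mul1r.
Qed.

Lemma scale_unit_ballE k :
  0 <= k -> set_scale k unit_ball = [set x : 'rV[R]_n | enorm x <= k].
Proof.
rewrite le_eqVlt => /predU1P[<-|k0]; apply/seteqP; split=> x.
- by move=> [y _ <-] /=; rewrite enormZ normr0 mul0r.
- move=> /(le_trans (normr_le_enorm x)); rewrite normr_le0 => /eqP ->.
  by exists 0; rewrite ?scaler0// /unit_ball /= enorm0.
- move=> [y y1 <-] /=; rewrite enormZ gtr0_norm//.
  by rewrite -[leRHS]mulr1 ler_pM2l.
- move=> /= xk; exists (k^-1 *: x); first exact: unit_ballZV.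
  by rewrite scalerA mulfV ?scale1r ?gt_eqF.
Qed.

End euclidean_norm.

Section prefan_norm.
Variables (R : realType) (m n : nat) (H : 'rV[R]_m -> set 'rV[R]_n).

Lemma enorm_le_outer_norm (M : R) : pos_homogeneous H ->
  (outer_norm H <= M%:E)%E -> forall w h, H w h -> enorm h <= M * enorm w.
Proof.
move=> [H00 HZ] HM.
have unitM w h : enorm w <= 1 -> H w h -> enorm h <= M.
  move=> w1 Hwh; rewrite -lee_fin; apply: le_trans HM.
  apply: le_trans (ereal_sup_ubound _); last by exists w.
  by apply: ereal_sup_ubound; exists h.
have M0 : 0 <= M.
  by apply: le_trans (enorm_ge0 0) (unitM 0 0 _ H00); rewrite enorm0.
move=> w h Hwh.
have scaledM (a : R) : enorm w < a -> enorm h <= M * a.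
  move=> wa; have a0 : 0 < a := le_lt_trans (enorm_ge0 w) wa.
  rewrite -ler_pdivrMr// mulrC -(gtr0_norm (_ : 0 < a^-1)) ?invr_gt0// -enormZ.
  apply: (unitM (a^-1 *: w)); first by apply: unit_ballZV => //; exact: ltW.
  by rewrite HZ ?invr_gt0//; exists h.
apply/ler_addgt0Pr => e e0; have M1_gt0 : 0 < M + 1 by rewrite ltr_wpDl.
apply: le_trans (scaledM (enorm w + e / (M + 1)) _) _.
  by rewrite ltrDl divr_gt0.
rewrite mulrDr lerD2l mulrCA ler_piMr ?(ltW e0)//.
by rewrite ler_pdivrMr// mul1r lerDl.
Qed.

Lemma prefan_bounded : prefan H ->
  exists2 k : R, 0 <= k & forall p h, H p h -> `|h| <= k * `|p|.
Proof.
move=> [homH _ ltHy].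
have [M M0 HM] : exists2 M : R, 0 <= M & (outer_norm H <= M%:E)%E.
  move: ltHy; case: (outer_norm H) => [M| |] //= _.
    by exists (Num.max M 0); rewrite ?lee_fin le_max lexx ?orbT.
  by exists 0; rewrite ?leNye.
exists (M * m%:R) => [|p h Hph]; first by rewrite mulr_ge0.
apply: le_trans (normr_le_enorm h) _.
apply: le_trans (enorm_le_outer_norm homH HM Hph) _.
by rewrite -mulrA ler_wpM2l// enorm_le_normr.
Qed.

Lemma mem_enlarge (delta : R) w h z : 0 <= delta -> H w h ->
  n%:R * `|z - h| <= delta * `|w| -> enlarge H delta w z.
Proof.
move=> delta0 Hwh zh; exists h, (z - h).
split=> //; last by rewrite addrC subrK.
rewrite scale_unit_ballE ?mulr_ge0 ?enorm_ge0//=.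
apply: le_trans (enorm_le_normr _) (le_trans zh _).
by rewrite ler_wpM2l// normr_le_enorm.
Qed.

End prefan_norm.

Lemma compact_descent (R : realType) (T : topologicalType) (C K P : set T)
    (phi : T -> R) (v0 : T) :
  closed C -> compact K -> continuous phi -> C v0 ->
  (forall v, C v -> phi v <= phi v0 -> K v) ->
  (forall v, C v -> phi v <= phi v0 -> ~ P v ->
     exists2 v', C v' & phi v' < phi v) ->
  exists v, [/\ C v, P v & phi v <= phi v0].
Proof.
move=> closedC compactK cphi Cv0 subK descent.
pose sublevel := C `&` phi @^-1` [set a | a <= phi v0].
have compact_sublevel : compact sublevel.
  apply: subclosed_compact compactK _; last by move=> v [Cv]; exact: subK.
  apply: closedI => //; apply: preimage_closed => [v _|]; first exact: cphi.
  exact: closed_le.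
have sub_v0 : sublevel v0 by split=> //=.
have [] := compact_EVT_min _ compact_sublevel (continuous_subspaceT cphi).
  by exists v0.
move=> v /set_mem[Cv vv0] minv; exists v; split=> //.
apply: contrapT => /(descent v Cv vv0)[v' Cv' v'v].
have sub_v' : sublevel v' by split=> //=; exact: le_trans (ltW v'v) vv0.
by have := minv v' (mem_set sub_v'); rewrite leNgt v'v.
Qed.

(* [(q, p)] is tangent to the graph of [S] at [(x, y)] up to an error [e] in the
   second component; for [e] tending to [0], [p] lies in the contingent
   derivative of [S] at [x] for [y] in the direction [q]. *)
Definition approx_graph_tangent (R : realType) (V W : normedModType R)
    (S : V -> set W) (e : R) (x : V) (y : W) (q : V) (p : W) : Prop :=
  forall s : R, 0 < s -> exists tau y',
    [/\ 0 < tau < s, S (x + tau *: q) y' & `|y' - y - tau *: p| <= tau * e].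

Lemma closed_gph_segment (R : realType) (V W : normedModType R) (S : V -> set W)
    (x q : V) : closed (gph S) ->
  closed [set v : R * W | 0 <= v.1 <= 1 /\ S (x + v.1 *: q) v.2].
Proof.
move=> closedS; apply: (@closedI _ (fst @^-1` `[0 : R, 1])
  ((fun v : R * W => (x + v.1 *: q, v.2)) @^-1` gph S)).
  by apply: preimage_closed => [v _|]; [exact: cvg_fst|exact: interval_closed].
apply: preimage_closed => // v _.
apply: (@cvg_pair _ _ _ _ (nbhs _) (nbhs _)); last exact: cvg_snd.
apply: cvgD; first exact: cvg_cst.
by apply: cvgZ; [exact: cvg_fst|exact: cvg_cst].
Qed.

Lemma continuous_segment_residual (R : realType) (W : normedModType R)
    (y p : W) : continuous (fun v : R * W => `|v.2 - y - v.1 *: p|).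
Proof.
move=> v; apply: cvg_norm; apply: cvgB.
  by apply: cvgB; [exact: cvg_snd|exact: cvg_cst].
by apply: cvgZ; [exact: cvg_fst|exact: cvg_cst].
Qed.

Lemma approx_graph_tangent_along (R : realType) (V W : normedModType R)
    (S : V -> set W) (e t : R) (x q : V) (y y' p : W) : t < 1 ->
  approx_graph_tangent S e (x + t *: q) y' q p ->
  exists t' y1, [/\ t < t' < 1, S (x + t' *: q) y1 &
    `|y1 - y - t' *: p| <= `|y' - y - t *: p| + (t' - t) * e].
Proof.
rewrite -subr_gt0 => t1 /(_ _ t1)[tau [y1 [/andP[tau0 tau1] Sy1 y1e]]].
exists (t + tau), y1; split; first by apply/andP; split; lra.
  by rewrite scalerDl addrA.
have -> : y1 - y - (t + tau) *: p = (y' - y - t *: p) + (y1 - y' - tau *: p).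
  by rewrite addrACA [y' - y + _]addrC subrKA scalerDl opprD.
by rewrite (le_trans (ler_normD _ _))// lerD2l [t + _]addrC addrK.
Qed.

Lemma approx_graph_tangent_segment (R : realType) (V : normedModType R)
    (m : nat) (S : V -> set 'rV[R]_m) (x q : V) (y p : 'rV[R]_m) (e d : R) :
  closed (gph S) -> S x y -> e < d ->
  (forall (t : R) y', 0 <= t <= 1 -> S (x + t *: q) y' ->
     `|y' - y - t *: p| <= d * t ->
     approx_graph_tangent S e (x + t *: q) y' q p) ->
  exists2 y', S (x + q) y' & `|y' - y - p| <= d.
Proof.
move=> closedS Sxy ed tangent.
pose phi (v : R * 'rV[R]_m) := `|v.2 - y - v.1 *: p| - d * v.1.
pose C := [set v : R * 'rV[R]_m | 0 <= v.1 <= 1 /\ S (x + v.1 *: q) v.2].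
pose K := `[0 : R, 1] `*` closed_ball_ Num.norm y (`|d| + `|p|).
have phi0 : phi (0, y) = 0.
  by rewrite /phi /= subrr scale0r subr0 normr0 mulr0 subrr.
have cphi : continuous phi.
  move=> v; apply: cvgB; last by apply: cvgM; [exact: cvg_cst|exact: cvg_fst].
  exact: continuous_segment_residual.
have compactK : compact K.
  apply: compact_setX; first exact: segment_compact.
  exact: compact_closed_ball_rV.
have subK v : C v -> phi v <= phi (0, y) -> K v.
  move: v => [t y'] [/= /andP[t0 t1] _]; rewrite phi0 /phi /= subr_le0 => yd.
  split; rewrite /closed_ball_ /= ?in_itv/= ?t0//.
  rewrite distrC -[_ - y](subrK (t *: p)) (le_trans (ler_normD _ _))// lerD//.
    rewrite (le_trans yd)// (le_trans (ler_norm _))//.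
    by rewrite normrM (ger0_norm t0) ler_piMr.
  by rewrite normrZ ger0_norm// ler_piMl.
have C0 : C (0, y) by rewrite /C /= lexx ler01 scale0r addr0.
have closedC : closed C by exact: closed_gph_segment.
have descent v : C v -> phi v <= phi (0, y) -> v.1 <> 1 ->
    exists2 v', C v' & phi v' < phi v.
  case: v => t y' [/= t01 Sy'] + /eqP tN1; rewrite phi0 /phi /= subr_le0 => yd.
  have [t0 t1] : 0 <= t /\ t < 1 by case/andP: t01 => t0; rewrite lt_neqAle tN1.
  have [t' [y1 [/andP[tt' t'1] Sy1 y1e]]] :=
    approx_graph_tangent_along y t1 (tangent t y' t01 Sy' yd).
  exists (t', y1); first by split=> //=; apply/andP; split; lra.
  have : 0 < (t' - t) * (d - e) by rewrite mulr_gt0// subr_gt0.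
  by rewrite /phi /=; lra.
have [[t y'] [[_ /= Sy'] /= t1]] :=
  compact_descent closedC compactK cphi C0 subK descent.
rewrite phi0 /phi /= t1 scale1r mulr1 subr_le0 => yd.
by exists y' => //; move: Sy'; rewrite t1 scale1r.
Qed.

Lemma approx_graph_tangent_decrease (R : realType) (V W : normedModType R)
    (S : V -> set W) (x q : V) (y v : W) (k e kappa : R) :
  0 < kappa -> k + kappa * e < kappa -> y != v -> `|q| <= k * `|v - y| ->
  approx_graph_tangent S (e * `|v - y|) x y q (v - y) ->
  exists x' y', S x' y' /\ kappa * `|y' - v| + `|x' - x| < kappa * `|y - v|.
Proof.
move=> kappa0 ke yNv; rewrite (distrC v) => qk.
move=> /(_ _ ltr01)[tau [y' [/andP[tau0 tau1] Sy' y'e]]].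
exists (x + tau *: q), y'; split=> //.
have y'v : `|y' - v| <= (1 - tau) * `|y - v| + tau * (e * `|y - v|).
  have -> : y' - v = (1 - tau) *: (y - v) + (y' - y - tau *: (v - y)).
    rewrite scalerBl scale1r -[X in _ - X + _]opprK -scalerN opprB opprK.
    by rewrite addrACA subrr addr0 addrC subrKA.
  rewrite (le_trans (ler_normD _ _))// lerD// normrZ ger0_norm//.
  by rewrite subr_ge0 ltW.
have xq : `|x + tau *: q - x| <= tau * (k * `|y - v|).
  by rewrite addrAC subrr add0r normrZ gtr0_norm// ler_pM2l.
have yv0 : 0 < `|y - v| by rewrite normr_gt0 subr_eq0.
have : 0 < tau * `|y - v| * (kappa - (k + kappa * e)).
  by rewrite !mulr_gt0// subr_gt0.
by move: y'v; rewrite -(ler_pM2l kappa0); lra.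
Qed.

Lemma approx_graph_tangent_metric_regularity (R : realType) (n m : nat)
    (S : 'rV[R]_n -> set 'rV[R]_m) (x0 : 'rV[R]_n) (y0 v : 'rV[R]_m)
    (k e kappa : R) :
  closed (gph S) -> S x0 y0 -> 0 < kappa -> k + kappa * e < kappa ->
  (forall x y, S x y -> `|x - x0| <= kappa * `|y0 - v| ->
     `|y - v| <= `|y0 - v| -> y != v ->
     exists2 q, `|q| <= k * `|v - y| &
       approx_graph_tangent S (e * `|v - y|) x y q (v - y)) ->
  exists2 x, S x v & `|x - x0| <= kappa * `|y0 - v|.
Proof.
move=> closedS Sxy0 kappa0 ke tangent.
pose phi (w : 'rV[R]_n * 'rV[R]_m) := kappa * `|w.2 - v| + `|w.1 - x0|.
pose K := closed_ball_ Num.norm x0 (kappa * `|y0 - v|)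
  `*` closed_ball_ Num.norm v `|y0 - v|.
have phi0 : phi (x0, y0) = kappa * `|y0 - v|.
  by rewrite /phi /= subrr normr0 addr0.
have cphi : continuous phi.
  move=> w; apply: cvgD.
    apply: cvgM; first exact: cvg_cst.
    by apply: cvg_norm; apply: cvgB; [exact: cvg_snd|exact: cvg_cst].
  by apply: cvg_norm; apply: cvgB; [exact: cvg_fst|exact: cvg_cst].
have compactK : compact K by apply: compact_setX; exact: compact_closed_ball_rV.
have bounds x y : phi (x, y) <= phi (x0, y0) ->
    `|x - x0| <= kappa * `|y0 - v| /\ `|y - v| <= `|y0 - v|.
  rewrite phi0 /phi /= => phixy; split; last rewrite -(ler_pM2l kappa0).
    by apply: le_trans phixy; rewrite lerDr mulr_ge0// ltW.
  by apply: le_trans phixy; rewrite lerDl.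
have subK w : gph S w -> phi w <= phi (x0, y0) -> K w.
  by case: w => x y _ /bounds[xx0 yv]; split; rewrite /closed_ball_ /= distrC.
have descent w : gph S w -> phi w <= phi (x0, y0) -> w.2 <> v ->
    exists2 w', gph S w' & phi w' < phi w.
  case: w => x y /= Sxy /bounds[xx0 yv] /eqP yNv.
  have [q qk tanq] := tangent x y Sxy xx0 yv yNv.
  have [x' [y' [Sx'y' decrease]]] :=
    approx_graph_tangent_decrease kappa0 ke yNv qk tanq.
  exists (x', y') => //; rewrite /phi /=.
  by have := ler_normD (x' - x) (x - x0); rewrite subrKA; lra.
have [[x y] [/= Sxy yv /bounds[xx0 _]]] :=
  compact_descent closedS compactK cphi (Sxy0 : gph S (x0, y0)) subK descent.
by exists x => //; rewrite -yv.
Qed.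

(* [Q p] collects the displacements of [x] that answer a change [p] of the
   parameter, the same ones at all points of the graph near [(xbar, ybar)]. *)
Section inverse_estimate.
Variables (R : realType) (n m : nat) (S : 'rV[R]_n -> set 'rV[R]_m).
Variables (xbar : 'rV[R]_n) (ybar : 'rV[R]_m).
Variables (Q : 'rV[R]_m -> set 'rV[R]_n) (k : R).
Hypothesis closedS : closed (gph S).
Hypothesis Q_neq0 : forall p, p != 0 -> Q p !=set0.
Hypothesis Q_bounded : forall p q, Q p q -> `|q| <= k * `|p|.

Lemma inverse_estimate_in_ball (kappa eps d r : R) x y p q :
  (forall x' y', S x' y' -> `|x' - xbar| < r -> `|y' - ybar| < r ->
     forall p' q', p' != 0 -> Q p' q' ->
     approx_graph_tangent S (eps * `|p'|) x' y' q' p') ->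
  0 < kappa -> k + kappa * eps < kappa -> 0 < d -> eps < d ->
  S x y -> p != 0 -> Q p q ->
  `|x - xbar| + (k + kappa * d) * `|p| < r ->
  `|y - ybar| + (1 + d) * `|p| < r ->
  exists2 x', S x' (y + p) & `|x' - x - q| <= kappa * d * `|p|.
Proof.
move=> tangent kappa0 keps d0 epsd Sxy p0 Qpq xr yr.
have np0 : 0 < `|p| by rewrite normr_gt0.
have qk : `|q| <= k * `|p| by exact: Q_bounded.
have kd0 : 0 < kappa * d * `|p| by rewrite !mulr_gt0.
have [y1 Sy1 y1d] : exists2 y1, S (x + q) y1 & `|y1 - y - p| <= d * `|p|.
  apply: (@approx_graph_tangent_segment _ _ _ _ _ _ _ _ (eps * `|p|)) => //.
    by rewrite ltr_pM2r.
  move=> t y' /andP[t0 t1] Sy' y'd; apply: tangent => //.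
    have : `|t *: q| <= `|q| by rewrite normrZ ger0_norm// ler_piMl.
    have := ler_normD (x - xbar) (t *: q); rewrite addrAC; lra.
  have tp : `|t *: p| <= `|p| by rewrite normrZ ger0_norm// ler_piMl.
  have td : d * `|p| * t <= d * `|p| by rewrite ler_piMr// mulr_ge0// ltW.
  have := ler_normD (y' - y - t *: p) (t *: p); rewrite subrK.
  have := ler_normD (y' - y) (y - ybar); rewrite subrKA; lra.
rewrite -addrA -opprD in y1d.
have [x' Sx' x'x] : exists2 x', S x' (y + p) &
    `|x' - (x + q)| <= kappa * `|y1 - (y + p)|.
  apply: (approx_graph_tangent_metric_regularity (k := k) (e := eps)) => //.
  move=> x2 y2 Sxy2 x2x y2y y2N.
  have pN0 : y + p - y2 != 0 by rewrite subr_eq0 eq_sym.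
  have [q2 Qq2] := Q_neq0 pN0; exists q2; first exact: Q_bounded.
  apply: tangent => //.
    have : kappa * `|y1 - (y + p)| <= kappa * (d * `|p|) by rewrite ler_pM2l.
    have := ler_normD (x2 - (x + q)) (x + q - xbar); rewrite subrKA.
    have := ler_normD (x - xbar) q; rewrite (addrAC x); lra.
  have := ler_normD (y2 - (y + p)) (y + p - ybar); rewrite subrKA.
  have := ler_normD (y - ybar) p; rewrite (addrAC y); lra.
exists x' => //; rewrite -addrA -opprD (le_trans x'x)// -mulrA.
by rewrite ler_pM2l.
Qed.

Hypothesis Q_tangent : forall eps, 0 < eps ->
  \forall xy \near (xbar, ybar), gph S xy ->
  forall p q, p != 0 -> Q p q ->
  approx_graph_tangent S (eps * `|p|) xy.1 xy.2 q p.

Lemma inverse_estimate (sigma : R) : 0 <= k -> 0 < sigma ->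
  exists2 r : R, 0 < r & forall x y y',
    ball xbar r x -> ball ybar r y -> ball ybar r y' -> S x y -> y' != y ->
  exists2 q, Q (y' - y) q &
    exists2 x', S x' y' & `|x' - x - q| <= sigma * `|y' - y|.
Proof.
move=> k0 sigma0.
pose kappa := 2 * (k + 1); pose d := sigma / kappa.
pose eps := Num.min (1 / 2) (d / 2).
have kappa0 : 0 < kappa by rewrite /kappa; lra.
have d0 : 0 < d by rewrite divr_gt0.
have eps0 : 0 < eps by rewrite lt_min; apply/andP; split; lra.
have epsd : eps < d by rewrite gt_min; apply/orP; right; lra.
have keps : k + kappa * eps < kappa.
  have : kappa * eps <= kappa * (1 / 2) by rewrite ler_pM2l// ge_min lexx.
  by rewrite /kappa; lra.
have kd : kappa * d = sigma by rewrite mulrC divfK// gt_eqF.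
have /nbhs_ballP[rho /= rho0 tangent] := Q_tangent eps0.
pose r := rho / (3 + 2 * (k + sigma + d)).
have r0 : 0 < r by rewrite divr_gt0//; lra.
have rE : r * (3 + 2 * (k + sigma + d)) = rho by rewrite divfK// gt_eqF//; lra.
exists r => // x y y'; rewrite -!ball_normE /=.
rewrite (distrC _ x) (distrC _ y) (distrC _ y') => xr yr y'r Sxy yy'.
have p0 : y' - y != 0 by rewrite subr_eq0.
have pr : `|y' - y| < 2 * r.
  by have := ler_normB (y' - ybar) (y - ybar); rewrite opprB subrKA; lra.
have kp : (k + sigma) * `|y' - y| <= (k + sigma) * (2 * r).
  by rewrite ler_wpM2l ?ltW//; lra.
have dp : (1 + d) * `|y' - y| <= (1 + d) * (2 * r).
  by rewrite ler_wpM2l ?ltW//; lra.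
have kr0 : 0 <= (k + sigma) * r by rewrite mulr_ge0 ?ltW//; lra.
have dr0 : 0 <= d * r by rewrite mulr_ge0 ?ltW//; lra.
have [q Qq] := Q_neq0 p0; exists q => //.
have [x1 y1 Sxy1 x1r y1r|||x' Sx' x'q] := inverse_estimate_in_ball
    (r := rho) _ kappa0 keps d0 epsd Sxy p0 Qq.
- apply: (tangent (x1, y1)) => //.
  by split; rewrite /= -ball_normE /= distrC.
- by rewrite kd; lra.
- lra.
by exists x'; [rewrite addrC subrK in Sx'|rewrite -kd].
Qed.

End inverse_estimate.

Lemma pseudo_strictly_differentiable_set_inv (R : realType) (n m : nat)
    (S : 'rV[R]_n -> set 'rV[R]_m) (H Q : 'rV[R]_m -> set 'rV[R]_n) xbar ybar :
  closed (gph S) -> prefan H -> S xbar ybar ->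
  (forall p, Q p `<=` [set - h | h in H (- p)]) ->
  (forall p, p != 0 -> Q p !=set0) ->
  (forall eps, 0 < eps -> \forall xy \near (xbar, ybar), gph S xy ->
     forall p q, p != 0 -> Q p q ->
     approx_graph_tangent S (eps * `|p|) xy.1 xy.2 q p) ->
  pseudo_strictly_differentiable H (set_inv S) ybar xbar.
Proof.
move=> closedS prefanH Sxy QH Q_neq0 Q_tangent; split=> // delta delta0.
have [k k0 H_bounded] := prefan_bounded prefanH.
have Q_bounded p q : Q p q -> `|q| <= k * `|p|.
  by move=> /QH[h /H_bounded]; rewrite normrN => hk <-; rewrite normrN.
have sigma0 : 0 < delta / n.+1%:R by rewrite divr_gt0.
have [r r0 estimate] :=
  inverse_estimate closedS Q_neq0 Q_bounded Q_tangent k0 sigma0.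
exists (ball ybar r), (ball xbar r); split; [exact: nbhsx_ballx..|].
move=> u u' ur u'r x [Sxu xr].
have [->|uu'] := eqVneq u' u.
  exists x, 0; rewrite addr0 subrr; split=> //.
  apply: (mem_enlarge (h := 0)) => //; first exact: ltW.
    by have [[]] := prefanH.
  by rewrite subrr !normr0 !mulr0.
have [q Qq [x' Sx' x'q]] := estimate x u u' xr ur u'r Sxu uu'.
exists x', (x - x'); split=> //; last by rewrite addrC subrK.
have [h Hh hq] := QH _ _ Qq; rewrite opprB in Hh.
apply: (mem_enlarge (h := h)) Hh _ => //; first exact: ltW.
have -> : x - x' - h = - (x' - x - q).
  by rewrite -hq opprK opprD opprB.
rewrite normrN (distrC u); apply: (@le_trans _ _ (n.+1%:R * `|x' - x - q|)).
  by rewrite ler_wpM2r// ler_nat.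
by rewrite mulrC -ler_pdivlMr// mulrAC.
Qed.

Lemma cvg_diff_quotient (R : realType) (V W : normedModType R) (F : V -> W)
    (x q : V) (tau : nat -> R) :
  derivable F x q -> (forall i, 0 < tau i) -> tau @ \oo --> (0 : R) ->
  (tau i)^-1 *: (F (x + tau i *: q) - F x) @[i --> \oo] --> 'D_q F x.
Proof.
move=> dF tau0 tau_cvg.
have tau_dnbhs : tau i @[i --> \oo] --> (0 : R)^'.
  move=> A A0; have := tau_cvg _ A0; rewrite !nbhs_simpl /=.
  by apply: filterS => i; apply; rewrite gt_eqF.
under eq_fun do rewrite [x + _]addrC.
exact: cvg_comp tau_dnbhs dF.
Qed.

Section tangent_cone.
Variables (R : realType) (N : nat) (C : set 'rV[R]_N).

Lemma tangent_coneZ z w (k : R) :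
  0 < k -> tangent_cone C z w -> tangent_cone C z (k *: w).
Proof.
move=> k0 [y [tau [Cy yz tau0 tau_cvg yw]]].
exists y, (fun i => k^-1 * tau i); split=> //.
- by move=> i; rewrite mulr_gt0 ?invr_gt0.
- by rewrite -[X in _ --> X](mulr0 k^-1); apply: cvgM => //; exact: cvg_cst.
- under eq_fun do rewrite invfM invrK -scalerA.
  by apply: cvgZ => //; exact: cvg_cst.
Qed.

Lemma near_clarke_regular zbar (rho eps : R) :
  clarke_regular C zbar -> 0 < eps ->
  \forall z \near zbar, C z -> forall w (a : R), 0 < a ->
    tangent_cone C zbar w -> `|w| <= rho * a ->
  exists2 w', tangent_cone C z w' & `|w - w'| <= eps * a.
Proof.
move=> regC eps0; pose rho' := N%:R * `|rho| + 1.
have rho'0 : 0 < rho' by rewrite ltr_wpDl// mulr_ge0.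
have [V Vzbar VC] := regC rho' eps rho'0 eps0.
apply: filterS Vzbar => z Vz Cz w a a0 Tw wa.
have [|w1 [w2 [Tw1 w2eps wE]]] := VC z (conj Cz Vz) (a^-1 *: w).
  split; first by apply: tangent_coneZ; rewrite ?invr_gt0.
  rewrite scale_unit_ballE ?ltW//=.
  apply: le_trans (enorm_le_normr _) _; rewrite ler_wpDr// ler_wpM2l//.
  rewrite normrZ gtr0_norm ?invr_gt0// mulrC ler_pdivrMr// (le_trans wa)//.
  by rewrite ler_pM2r// ler_norm.
exists (a *: w1); first exact: tangent_coneZ.
have -> : w - a *: w1 = a *: w2.
  rewrite -[w2](addKr w1) -wE scalerDr scalerN scalerA mulfV ?gt_eqF//.
  by rewrite scale1r addrC.
rewrite scale_unit_ballE ?ltW//= in w2eps.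
rewrite normrZ gtr0_norm// mulrC ler_pM2r//.
exact: le_trans (normr_le_enorm _) w2eps.
Qed.

End tangent_cone.

Definition constraint_map (T : Type) (W : zmodType) (F : T -> W) (D : set W)
  (x : T) : set W := [set y | D (F x - y)].

Lemma cvg_sub_snd (R : realType) (T : topologicalType)
    (W : normedModType R) (F : T -> W) (x : T) (y : W) :
  {for x, continuous F} ->
  F xy.1 - xy.2 @[xy --> (x, y)] --> F x - y.
Proof.
move=> cF; apply: cvgB; last exact: cvg_snd.
exact: (cvg_comp _ _ (cvg_fst (F := nbhs x) (G := nbhs y)) cF).
Qed.

Lemma closed_gph_constraint_map (R : realType) (T : topologicalType)
    (W : normedModType R) (F : T -> W) (D : set W) :
  continuous F -> closed D -> closed (gph (constraint_map F D)).
Proof.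
move=> cF; apply: preimage_closed => -[x y] _.
by apply: cvg_sub_snd; exact: cF.
Qed.

Section constraint_tangent.
Variables (R : realType) (n m : nat).
Variables (F : 'rV[R]_n -> 'rV[R]_m) (D : set 'rV[R]_m).

Lemma approx_graph_tangent_constraint_map x y q p w (e : R) :
  differentiable F x -> tangent_cone D (F x - y) w ->
  `|q *m 'J F x - w - p| < e ->
  approx_graph_tangent (constraint_map F D) e x y q p.
Proof.
move=> dF [z [tau [Dz _ tau0 tau_cvg zw]]] he s s0.
have error_cvg : `|(tau i)^-1 *: (F (x + tau i *: q) - F x) -
      (tau i)^-1 *: (z i - (F x - y)) - p| @[i --> \oo]
    --> `|q *m 'J F x - w - p|.
  apply: cvg_norm; apply: cvgB; last exact: cvg_cst.
  apply: cvgB => //; rewrite -deriveEjacobian//.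
  by apply: cvg_diff_quotient => //; exact: diff_derivable.
near \oo => i; exists (tau i), (F (x + tau i *: q) - z i); split.
- by rewrite tau0 /=; near: i; exact: (cvgr_lt _ tau_cvg).
- by rewrite /constraint_map /= subKr.
- have -> : F (x + tau i *: q) - z i - y - tau i *: p =
      tau i *: ((tau i)^-1 *: (F (x + tau i *: q) - F x) -
                (tau i)^-1 *: (z i - (F x - y)) - p).
    rewrite !scalerBr !scalerA mulfV ?gt_eqF// !scale1r.
    by rewrite opprB [F x - y - _]addrAC -[F x - _ - y]addrA subrKA addrA.
  rewrite normrZ gtr0_norm// ler_pM2l//; apply: ltW; near: i.
  exact: (cvgr_lt _ error_cvg).
Unshelve. all: by end_near.
Qed.

Lemma near_jacobian_mulmx_le x (eps : R) : smooth F -> 0 < eps ->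
  \forall x' \near x, forall q : 'rV[R]_n,
    `|q *m ('J F x' - 'J F x)| <= eps * `|q|.
Proof.
move=> [_ cJ] eps0.
have epsn : 0 < eps / n.+1%:R by rewrite divr_gt0.
have /cvgrPdist_le/(_ _ epsn) := cJ x; apply: filterS => x' Jx' q.
apply: le_trans (normr_mulmx_le _ _) _; rewrite distrC in Jx'.
rewrite mulrAC ler_wpM2r//; rewrite ler_pdivlMr// mulrC in Jx'.
by apply: le_trans Jx'; rewrite ler_wpM2r// ler_nat.
Qed.

Lemma near_approx_graph_tangent_constraint_map x (y : 'rV[R]_m) (k eps : R) :
  smooth F -> clarke_regular D (F x - y) -> 0 <= k -> 0 < eps ->
  \forall xy \near (x, y), gph (constraint_map F D) xy ->
  forall p q, p != 0 -> `|q| <= k * `|p| ->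
  tangent_cone D (F x - y) (q *m 'J F x - p) ->
  approx_graph_tangent (constraint_map F D) (eps * `|p|) xy.1 xy.2 q p.
Proof.
move=> smoothF regD k0 eps0; have eps3 : 0 < eps / 3 by rewrite divr_gt0.
pose rho := n%:R * k * `|'J F x| + 1.
have k1_gt0 : 0 < k + 1 by rewrite ltr_wpDl.
have near_tangent : \forall xy \near (x, y), gph (constraint_map F D) xy ->
    forall w (a : R), 0 < a -> tangent_cone D (F x - y) w -> `|w| <= rho * a ->
    exists2 w', tangent_cone D (F xy.1 - xy.2) w' & `|w - w'| <= eps / 3 * a.
  apply: (cvg_sub_snd (y := y) _ (near_clarke_regular rho regD eps3)).
  exact: differentiable_continuous (smoothF.1 x).
have near_jacobian : \forall xy \near (x, y), forall q : 'rV[R]_n,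
    `|q *m ('J F xy.1 - 'J F x)| <= eps / 3 / (k + 1) * `|q|.
  have near_x := near_jacobian_mulmx_le x smoothF (divr_gt0 eps3 k1_gt0).
  exact: (@cvg_fst _ _ (nbhs x) (nbhs y) _ _ near_x).
move: near_tangent near_jacobian; apply: filterS2 => xy tangent jacobian.
move=> Dxy p q p0 qk Tw.
have np0 : 0 < `|p| by rewrite normr_gt0.
have w_le : `|q *m 'J F x - p| <= rho * `|p|.
  rewrite (le_trans (ler_normB _ _))// /rho mulrDl mul1r lerD2r.
  rewrite (le_trans (normr_mulmx_le _ _))// [leRHS]mulrAC -[_ * k * _]mulrA.
  by rewrite ler_wpM2r// ler_wpM2l.
have [w Tw' ww] := tangent Dxy _ _ np0 Tw w_le.
apply: (approx_graph_tangent_constraint_map (smoothF.1 _) Tw').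
have -> : q *m 'J F xy.1 - w - p =
    q *m ('J F xy.1 - 'J F x) + (q *m 'J F x - p - w).
  by rewrite mulmxBr addrA subrKA addrAC.
rewrite (le_lt_trans (ler_normD _ _))//.
have Jq : `|q *m ('J F xy.1 - 'J F x)| <= eps / 3 * `|p|.
  rewrite (le_trans (jacobian q))// mulrAC ler_pdivrMr//.
  by rewrite -[leRHS]mulrA ler_pM2l// (le_trans qk)// mulrC ler_wpM2l// lerDl.
have : 0 < eps * `|p| by rewrite mulr_gt0.
by move: Jq ww; lra.
Qed.

End constraint_tangent.

Theorem proposition6p1 (R : realType) (n m : nat)
    (F : 'rV[R]_n -> 'rV[R]_m) (hF : smooth F)
    (D : set 'rV[R]_m) (hD : closed D)
    (hreg : forall d : 'rV[R]_m, D d -> clarke_regular D d)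
    (S : 'rV[R]_n -> set 'rV[R]_m)
    (hS : forall x : 'rV[R]_n, S x = [set F x - d | d in D])
    (xbar : 'rV[R]_n) (ubar : 'rV[R]_m) (hbar : gph S (xbar, ubar)) :
  (forall u : 'rV[R]_m, set_inv S u = [set x | D (F x - u)]) /\
  (forall H : 'rV[R]_m -> set 'rV[R]_n,
     prefan H ->
     (forall p : 'rV[R]_m, p <> 0 ->
        exists2 q : 'rV[R]_n, [set - h | h in H (- p)] q &
          tangent_cone D (F xbar - ubar) (q *m 'J F xbar - p)) ->
     pseudo_strictly_differentiable H (set_inv S) ubar xbar).
Proof.
have {hS} SE : S = constraint_map F D.
  apply/funext => x; rewrite hS; apply/seteqP; split=> [_ [d Dd <-]|y Dy].
    by rewrite /constraint_map /= subKr.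
  by exists (F x - y); rewrite ?subKr.
rewrite SE in hbar *; split=> // H prefanH dirH.
pose Q (p : 'rV[R]_m) := [set - h | h in H (- p)] `&`
  [set q | tangent_cone D (F xbar - ubar) (q *m 'J F xbar - p)].
have cF : continuous F by move=> x; exact: differentiable_continuous (hF.1 x).
have [k k0 H_bounded] := prefan_bounded prefanH.
apply: (pseudo_strictly_differentiable_set_inv (Q := Q)) => //.
- exact: closed_gph_constraint_map.
- by move=> p q [].
- by move=> p /eqP/dirH[q Hq Tq]; exists q.
- move=> eps eps0.
  have := near_approx_graph_tangent_constraint_map hF (hreg _ hbar) k0 eps0.
  apply: filterS => xy tangent Sxy p q p0 [[h /H_bounded hk <-] Tq].
  by apply: tangent => //; rewrite normrN -(normrN p).
Qed.
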